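(* Let $\mathbb{F}$ be a field and $\Gamma$ an arbitrary digraph. Let $\{C_i=e_iq_i\}_{i\in I}$ be a collection of distinct geometric cycles with no exit in $\Gamma$, where $e_i\in E$ is the initial arrow of the chosen representative $C_i$ and $q_i$ is the remaining path. Let $\Lambda$ be the digraph obtained from $\Gamma$ by replacing each arrow $e_i$ with a loop $e_i'$ with $s(e_i')=t(e_i')=s(e_i)$ (all vertices and all other arrows unchanged). Then $L_{\mathbb{F}}(\Gamma)$ is isomorphic to $L_{\mathbb{F}}(\Lambda)$ as $*$-algebras.
   Context: A digraph $\Gamma=(V,E,s,t)$ consists of arbitrary (possibly infinite) sets $V$ of vertices and $E$ of arrows and functions $s,t:E\to V$ (source, target). The Leavitt path algebra $L_{\mathbb{F}}(\Gamma)$ is the (not necessarily unital) $\mathbb{F}$-algebra generated by $V\sqcup E\sqcup\{e^*: e\in E\}$ subject to: $uv=\delta_{u,v}u$ for $u,v\in V$; $s(e)e=e=e\,t(e)$ and $t(e)e^*=e^*=e^*s(e)$ for $e\in E$; (CK1) $e^*f=\delta_{e,f}t(e)$; (CK2) $v=\sum_{s(e)=v}ee^*$ for every $v$ with $0<|s^{-1}(v)|<\infty$. $*$-structure: fix an automorphism $\lambda\mapsto\lambda^*$ of $\mathbb{F}$ with $(\lambda^* )^*=\lambda$ (e.g. the identity). For a path $p=e_1\cdots e_n$ put $p^*=e_n^*\cdots e_1^*$, and $v^*=v$ for vertices. $L_{\mathbb{F}}(\Gamma)$ is a $*$-algebra via $(\sum\lambda_ip_iq_i^* )^*=\sum\lambda_i^*q_ip_i^*$.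 An isomorphism of $*$-algebras is an $\mathbb{F}$-algebra isomorphism commuting with $*$. A path of length $n>0$ is a sequence of arrows $e_1\cdots e_n$ with $t(e_i)=s(e_{i+1})$; paths of length $0$ are vertices. A cycle is a path $C=e_1\cdots e_n$ with $n>0$, $s(C)=t(C)$ and $s(e_1),\dots,s(e_n)$ distinct; a geometric cycle is a cycle up to cyclic rotation. An exit of a path $p$ is an arrow not on $p$ whose source is a vertex on $p$. *)

(* Defs.v *)
From HB Require Import structures.
From mathcomp Require Import all_boot all_algebra generic_quotient.
From mathcomp Require Import boolp.
From Stdlib Require List.

Set Implicit Arguments.
Unset Strict Implicit.
Unset Printing Implicit Defensive.

Import GRing.Theory.
Local Open Scope ring_scope.
Local Open Scope quotient_scope.

(* Not necessarily unital associative algebras: MathComp rings have a 1. *)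
Record nualg (F : fieldType) := Nualg {
  nualg_sort :> lmodType F;
  nmul : nualg_sort -> nualg_sort -> nualg_sort;
  nmulA : associative nmul;
  nmulDl : left_distributive nmul +%R;
  nmulDr : right_distributive nmul +%R;
  nscalerAl : forall a x y, a *: nmul x y = nmul (a *: x) y;
  nscalerAr : forall a x y, a *: nmul x y = nmul x (a *: y) }.

(* [conj] is the chosen involution of the field. *)
Record star_alg (F : fieldType) (conj : F -> F) := StarAlg {
  star_alg_nualg :> nualg F;
  star : star_alg_nualg -> star_alg_nualg;
  starD : {morph star : x y / x + y};
  starZ : forall a x, star (a *: x) = conj a *: star x;
  starM : forall x y, star (nmul x y) = nmul (star y) (star x);
  starK : involutive star }.

Definition star_isomorphic (F : fieldType) (conj : F -> F)
    (A B : star_alg conj) : Prop :=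
  exists phi : {linear A -> B},
    [/\ bijective phi,
        forall x y, phi (nmul x y) = nmul (phi x) (phi y) &
        forall x, phi (star x) = star (phi x)].

Inductive nterm (F X : Type) : Type :=
| TGen of X
| TZero
| TAdd of nterm F X & nterm F X
| TScale of F & nterm F X
| TMul of nterm F X & nterm F X.

Arguments TGen {F X}.
Arguments TZero {F X}.

(* The least congruence containing the relations [R] whose quotient is a
   non-unital F-algebra. *)
Inductive ncong (F : fieldType) (X : Type)
    (R : nterm F X -> nterm F X -> Prop) : nterm F X -> nterm F X -> Prop :=
| nc_rel x y : R x y -> ncong R x y
| nc_refl x : ncong R x x
| nc_sym x y : ncong R x y -> ncong R y x
| nc_trans y x z : ncong R x y -> ncong R y z -> ncong R x z
| nc_add x x' y y' :
    ncong R x x' -> ncong R y y' -> ncong R (TAdd x y) (TAdd x' y')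
| nc_scale a x x' : ncong R x x' -> ncong R (TScale a x) (TScale a x')
| nc_mul x x' y y' :
    ncong R x x' -> ncong R y y' -> ncong R (TMul x y) (TMul x' y')
| nc_addA x y z : ncong R (TAdd x (TAdd y z)) (TAdd (TAdd x y) z)
| nc_addC x y : ncong R (TAdd x y) (TAdd y x)
| nc_add0 x : ncong R (TAdd TZero x) x
| nc_addN x : ncong R (TAdd (TScale (-1) x) x) TZero
| nc_scaleA a b x : ncong R (TScale a (TScale b x)) (TScale (a * b) x)
| nc_scale1 x : ncong R (TScale 1 x) x
| nc_scaleDr a x y :
    ncong R (TScale a (TAdd x y)) (TAdd (TScale a x) (TScale a y))
| nc_scaleDl a b x :
    ncong R (TScale (a + b) x) (TAdd (TScale a x) (TScale b x))
| nc_mulA x y z : ncong R (TMul x (TMul y z)) (TMul (TMul x y) z)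
| nc_mulDl x y z : ncong R (TMul (TAdd x y) z) (TAdd (TMul x z) (TMul y z))
| nc_mulDr x y z : ncong R (TMul x (TAdd y z)) (TAdd (TMul x y) (TMul x z))
| nc_scaleAl a x y : ncong R (TScale a (TMul x y)) (TMul (TScale a x) y)
| nc_scaleAr a x y : ncong R (TScale a (TMul x y)) (TMul x (TScale a y)).

HB.instance Definition _ (F X : Type) := gen_eqMixin (nterm F X).
HB.instance Definition _ (F X : Type) := gen_choiceMixin (nterm F X).

Section Presented.
Context {F : fieldType} {X : Type} (R : nterm F X -> nterm F X -> Prop).

Definition ncongb : rel (nterm F X) := fun x y => `[< ncong R x y >].

Lemma ncongb_refl : reflexive ncongb.
Proof. by move=> x; apply/asboolP/nc_refl. Qed.

Lemma ncongb_sym : symmetric ncongb.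
Proof. by move=> x y; apply/asboolP/asboolP => /nc_sym. Qed.

Lemma ncongb_trans : transitive ncongb.
Proof.
by move=> y x z /asboolP xy /asboolP yz; apply/asboolP; apply: nc_trans xy yz.
Qed.

Canonical ncongb_equiv := EquivRel ncongb ncongb_refl ncongb_sym ncongb_trans.

Definition presented : Type := {eq_quot ncongb_equiv}.
HB.instance Definition _ := Choice.on presented.
HB.instance Definition _ := Quotient.on presented.

Definition npi (t : nterm F X) : presented := \pi_presented t.

Lemma npiP (x y : nterm F X) : npi x = npi y <-> ncong R x y.
Proof.
by split=> [/eqmodP/asboolP|xy] //; apply/eqmodP/asboolP.
Qed.

Lemma npiK (x : presented) : npi (repr x) = x.
Proof. exact: reprK. Qed.

Lemma repr_npi (t : nterm F X) : ncong R (repr (npi t)) t.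
Proof. by apply/npiP; rewrite npiK. Qed.

Lemma npi_ind (P : presented -> Prop) : (forall t, P (npi t)) -> forall x, P x.
Proof. by move=> Pt x; rewrite -(npiK x). Qed.

Definition padd (x y : presented) := npi (TAdd (repr x) (repr y)).
Definition pscale (a : F) (x : presented) := npi (TScale a (repr x)).
Definition pmul (x y : presented) := npi (TMul (repr x) (repr y)).

Lemma paddE x y : padd (npi x) (npi y) = npi (TAdd x y).
Proof. by apply/npiP/nc_add; apply: repr_npi. Qed.

Lemma pscaleE a x : pscale a (npi x) = npi (TScale a x).
Proof. by apply/npiP/nc_scale; apply: repr_npi. Qed.

Lemma pmulE x y : pmul (npi x) (npi y) = npi (TMul x y).
Proof. by apply/npiP/nc_mul; apply: repr_npi. Qed.

Lemma paddA : associative padd.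
Proof.
elim/npi_ind=> x; elim/npi_ind=> y; elim/npi_ind=> z.
by rewrite !paddE; apply/npiP/nc_addA.
Qed.

Lemma paddC : commutative padd.
Proof.
by elim/npi_ind=> x; elim/npi_ind=> y; rewrite !paddE; apply/npiP/nc_addC.
Qed.

Lemma padd0 : left_id (npi TZero) padd.
Proof. by elim/npi_ind=> x; rewrite !paddE; apply/npiP/nc_add0. Qed.

Lemma paddN : left_inverse (npi TZero) (pscale (-1)) padd.
Proof. by elim/npi_ind=> x; rewrite pscaleE paddE; apply/npiP/nc_addN. Qed.

HB.instance Definition _ :=
  GRing.isZmodule.Build presented paddA paddC padd0 paddN.

Lemma pscaleA a b x : pscale a (pscale b x) = pscale (a * b) x.
Proof. by elim/npi_ind: x => x; rewrite !pscaleE; apply/npiP/nc_scaleA. Qed.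

Lemma pscale1 : left_id 1 pscale.
Proof. by elim/npi_ind=> x; rewrite !pscaleE; apply/npiP/nc_scale1. Qed.

Lemma pscaleDr : right_distributive pscale +%R.
Proof.
move=> a; elim/npi_ind=> x; elim/npi_ind=> y.
by rewrite /GRing.add /= paddE !pscaleE paddE; apply/npiP/nc_scaleDr.
Qed.

Lemma pscaleDl x : {morph pscale^~ x : a b / a + b}.
Proof.
elim/npi_ind: x => x a b.
by rewrite [in RHS]/GRing.add /= !pscaleE paddE; apply/npiP/nc_scaleDl.
Qed.

HB.instance Definition _ :=
  GRing.Zmodule_isLmodule.Build F presented
    pscaleA pscale1 pscaleDr pscaleDl.

Lemma npiD x y : npi (TAdd x y) = npi x + npi y.
Proof. by rewrite -paddE. Qed.

Lemma npiZ a x : npi (TScale a x) = a *: npi x.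
Proof. by rewrite -pscaleE. Qed.

Lemma npi0 : npi TZero = 0.
Proof. by []. Qed.

Lemma pmulA : associative pmul.
Proof.
elim/npi_ind=> x; elim/npi_ind=> y; elim/npi_ind=> z.
by rewrite !pmulE; apply/npiP/nc_mulA.
Qed.

Lemma pmulDl : left_distributive pmul +%R.
Proof.
elim/npi_ind=> x; elim/npi_ind=> y; elim/npi_ind=> z.
by rewrite -npiD !pmulE -npiD; apply/npiP/nc_mulDl.
Qed.

Lemma pmulDr : right_distributive pmul +%R.
Proof.
elim/npi_ind=> x; elim/npi_ind=> y; elim/npi_ind=> z.
by rewrite -npiD !pmulE -npiD; apply/npiP/nc_mulDr.
Qed.

Lemma pscaleAl a x y : a *: pmul x y = pmul (a *: x) y.
Proof.
elim/npi_ind: x => x; elim/npi_ind: y => y.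
by rewrite -(npiZ a x) !pmulE -npiZ; apply/npiP/nc_scaleAl.
Qed.

Lemma pscaleAr a x y : a *: pmul x y = pmul x (a *: y).
Proof.
elim/npi_ind: x => x; elim/npi_ind: y => y.
by rewrite -(npiZ a y) !pmulE -npiZ; apply/npiP/nc_scaleAr.
Qed.

Definition presented_nualg : nualg F :=
  @Nualg F presented pmul pmulA pmulDl pmulDr pscaleAl pscaleAr.

End Presented.

Fixpoint nterm_eval (F : fieldType) (X : Type) (A : nualg F) (f : X -> A)
    (t : nterm F X) : A :=
  match t with
  | TGen x => f x
  | TZero => 0
  | TAdd x y => nterm_eval f x + nterm_eval f y
  | TScale a x => a *: nterm_eval f x
  | TMul x y => nmul (nterm_eval f x) (nterm_eval f y)
  end.

Lemma nterm_eval_cong (F : fieldType) (X : Type)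
    (R : nterm F X -> nterm F X -> Prop) (A : nualg F) (f : X -> A) :
  (forall x y, R x y -> nterm_eval f x = nterm_eval f y) ->
  forall x y, ncong R x y -> nterm_eval f x = nterm_eval f y.
Proof.
move=> fR x y; elim=> {x y} //=.
- by move=> y x z _ -> _ ->.
- by move=> x x' y y' _ -> _ ->.
- by move=> a x x' _ ->.
- by move=> x x' y y' _ -> _ ->.
- by move=> x y z; rewrite addrA.
- by move=> x y; rewrite addrC.
- by move=> x; rewrite add0r.
- by move=> x; rewrite scaleN1r addNr.
- by move=> a b x; rewrite scalerA.
- by move=> x; rewrite scale1r.
- by move=> a x y; rewrite scalerDr.
- by move=> a b x; rewrite scalerDl.
- by move=> x y z; rewrite nmulA.
- by move=> x y z; rewrite nmulDl.
- by move=> x y z; rewrite nmulDr.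
- by move=> a x y; rewrite nscalerAl.
- by move=> a x y; rewrite nscalerAr.
Qed.

Lemma presented_lift (F : fieldType) (X : Type)
    (R : nterm F X -> nterm F X -> Prop) (A : nualg F) (f : X -> A) :
  (forall x y, R x y -> nterm_eval f x = nterm_eval f y) ->
  exists phi : {linear presented_nualg R -> A},
    (forall x y, phi (nmul x y) = nmul (phi x) (phi y)) /\
    (forall x, phi (npi R (TGen x)) = f x).
Proof.
move=> fR; pose phi (x : presented R) : A := nterm_eval f (repr x).
have phiE t : phi (npi R t) = nterm_eval f t.
  exact: (nterm_eval_cong fR (repr_npi R t)).
have phi_lin : linear phi.
  move=> a; elim/(@npi_ind F X R)=> x; elim/(@npi_ind F X R)=> y.
  by rewrite -npiZ -npiD !phiE.
pose phiM := GRing.isLinear.Build F (presented R) A *:%R phi phi_lin.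
pose phiL : {linear presented_nualg R -> A} := HB.pack phi phiM.
exists phiL; split=> [|x]; last exact: (phiE (TGen x)).
elim/(@npi_ind F X R)=> x; elim/(@npi_ind F X R)=> y.
by rewrite /phiL /= pmulE !phiE.
Qed.

Record digraph := Digraph {
  vertex : Type;
  arrow : Type;
  source : arrow -> vertex;
  target : arrow -> vertex }.

Arguments source {d}.
Arguments target {d}.

(* Paths of positive length are nonempty lists of composable arrows. *)
Fixpoint composable (G : digraph) (p : seq (arrow G)) : Prop :=
  match p with
  | e :: ((f :: _) as q) => target e = source f /\ composable q
  | _ => True
  end.

Definition is_cycle (G : digraph) (p : seq (arrow G)) : Prop :=
  match p with
  | [::] => False
  | e :: q => [/\ composable p, target (last e q) = source e &
                  List.NoDup (map source p)]
  end.

(* Two cycles represent the same geometric cycle. *)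
Definition cyclic_rotation (G : digraph) (p q : seq (arrow G)) : Prop :=
  exists n, q = rot n p.

Definition vertex_on (G : digraph) (p : seq (arrow G)) (v : vertex G) : Prop :=
  exists2 e, List.In e p & v = source e \/ v = target e.

Definition is_exit (G : digraph) (p : seq (arrow G)) (f : arrow G) : Prop :=
  ~ List.In f p /\ vertex_on p (source f).

(* Each arrow e i is replaced by a loop at its source. The loop reuses the
   label e i, so only the target map changes. *)
Definition replace_by_loops (G : digraph) (I : Type) (e : I -> arrow G) :
    digraph :=
  @Digraph (vertex G) (arrow G) source
    (fun f => if pselect (exists i, f = e i) then source f else target f).

Variant leavitt_gen (G : digraph) : Type :=
| Vert of vertex G
| Arr of arrow G
| Ghost of arrow G.

Arguments Vert {G}.
Arguments Arr {G}.
Arguments Ghost {G}.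

Section Leavitt.
Context (F : fieldType) (G : digraph).

Local Notation term := (nterm F (leavitt_gen G)).
Local Notation tV v := (TGen (Vert v) : term).
Local Notation tE e := (TGen (Arr e) : term).
Local Notation tE' e := (TGen (Ghost e) : term).

(* In CK2, the list s enumerates without repetition the arrows leaving v;
   its existence means that this set is finite. *)
Inductive leavitt_rel : term -> term -> Prop :=
| rel_VV v : leavitt_rel (TMul (tV v) (tV v)) (tV v)
| rel_V0 u v : u <> v -> leavitt_rel (TMul (tV u) (tV v)) TZero
| rel_sE e : leavitt_rel (TMul (tV (source e)) (tE e)) (tE e)
| rel_Et e : leavitt_rel (TMul (tE e) (tV (target e))) (tE e)
| rel_tE' e : leavitt_rel (TMul (tV (target e)) (tE' e)) (tE' e)
| rel_E's e : leavitt_rel (TMul (tE' e) (tV (source e))) (tE' e)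
| rel_CK1 e : leavitt_rel (TMul (tE' e) (tE e)) (tV (target e))
| rel_CK10 e f : e <> f -> leavitt_rel (TMul (tE' e) (tE f)) TZero
| rel_CK2 v (s : seq (arrow G)) :
    s <> [::] -> List.NoDup s ->
    (forall e, List.In e s <-> source e = v) ->
    leavitt_rel (tV v)
      (foldr (@TAdd F _) TZero [seq TMul (tE e) (tE' e) | e <- s]).

Definition leavitt_nualg : nualg F := presented_nualg leavitt_rel.

Definition lvert (v : vertex G) : leavitt_nualg := npi leavitt_rel (tV v).
Definition larr (e : arrow G) : leavitt_nualg := npi leavitt_rel (tE e).
Definition lghost (e : arrow G) : leavitt_nualg := npi leavitt_rel (tE' e).

Definition gen_star (g : leavitt_gen G) : leavitt_gen G :=
  match g with Vert v => Vert v | Arr e => Ghost e | Ghost e => Arr e end.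

Lemma gen_starK : involutive gen_star.
Proof. by case. Qed.

Context (conj : {rmorphism F -> F}).

Fixpoint tstar (t : term) : term :=
  match t with
  | TGen g => TGen (gen_star g)
  | TZero => TZero
  | TAdd x y => TAdd (tstar x) (tstar y)
  | TScale a x => TScale (conj a) (tstar x)
  | TMul x y => TMul (tstar y) (tstar x)
  end.

Lemma tstar_rel x y : leavitt_rel x y -> ncong leavitt_rel (tstar x) (tstar y).
Proof.
case=> /=.
- by move=> v; apply/nc_rel/rel_VV.
- by move=> u v uv; apply/nc_rel/rel_V0 => /esym.
- by move=> e; apply/nc_rel/rel_E's.
- by move=> e; apply/nc_rel/rel_tE'.
- by move=> e; apply/nc_rel/rel_Et.
- by move=> e; apply/nc_rel/rel_sE.
- by move=> e; apply/nc_rel/rel_CK1.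
- by move=> e f ef; apply/nc_rel/rel_CK10 => /esym.
- move=> v s s0 us sP; apply: nc_trans (nc_rel (rel_CK2 s0 us sP)) _.
  suff -> : tstar (foldr (@TAdd F _) TZero [seq TMul (tE e) (tE' e) | e <- s])
          = foldr (@TAdd F _) TZero [seq TMul (tE e) (tE' e) | e <- s].
    exact: nc_refl.
  by elim: s {s0 us sP} => //= e s ->.
Qed.

Lemma tstar_cong x y :
  ncong leavitt_rel x y -> ncong leavitt_rel (tstar x) (tstar y).
Proof.
elim=> {x y} /=.
- by move=> x y; apply: tstar_rel.
- by move=> x; apply: nc_refl.
- by move=> x y _; apply: nc_sym.
- by move=> y x z _ xy _; apply: nc_trans xy.
- by move=> *; apply: nc_add.
- by move=> *; apply: nc_scale.
- by move=> *; apply: nc_mul.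
- by move=> *; apply: nc_addA.
- by move=> *; apply: nc_addC.
- by move=> *; apply: nc_add0.
- by move=> x; rewrite rmorphN1; apply: nc_addN.
- by move=> a b x; rewrite rmorphM; apply: nc_scaleA.
- by move=> x; rewrite rmorph1; apply: nc_scale1.
- by move=> *; apply: nc_scaleDr.
- by move=> a b x; rewrite rmorphD; apply: nc_scaleDl.
- by move=> *; apply/nc_sym/nc_mulA.
- by move=> *; apply: nc_mulDr.
- by move=> *; apply: nc_mulDl.
- by move=> *; apply: nc_scaleAr.
- by move=> *; apply: nc_scaleAl.
Qed.

Definition leavitt_star (x : leavitt_nualg) : leavitt_nualg :=
  npi leavitt_rel (tstar (repr (x : presented leavitt_rel))).

Lemma leavitt_starE t :
  leavitt_star (npi leavitt_rel t) = npi leavitt_rel (tstar t).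
Proof. by apply/npiP/tstar_cong/repr_npi. Qed.

Lemma leavitt_starD : {morph leavitt_star : x y / x + y}.
Proof.
elim/(@npi_ind F _ leavitt_rel)=> x; elim/(@npi_ind F _ leavitt_rel)=> y.
by rewrite -npiD !leavitt_starE /= npiD.
Qed.

Lemma leavitt_starZ a x : leavitt_star (a *: x) = conj a *: leavitt_star x.
Proof. by elim/(@npi_ind F _ leavitt_rel): x => x; rewrite -npiZ !leavitt_starE /= npiZ. Qed.

Lemma leavitt_starM x y :
  leavitt_star (nmul x y) = nmul (leavitt_star y) (leavitt_star x).
Proof.
elim/(@npi_ind F _ leavitt_rel): x => x; elim/(@npi_ind F _ leavitt_rel): y => y.
by rewrite /= pmulE !leavitt_starE /= pmulE.
Qed.

Context (conjK : involutive conj).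

Lemma leavitt_starK : involutive leavitt_star.
Proof.
elim/(@npi_ind F _ leavitt_rel)=> x; rewrite !leavitt_starE; congr (npi _ _).
by elim: x => /= [[]|||a x|] // => [x -> y ->|->|x -> y ->]; rewrite ?conjK.
Qed.

Definition leavitt : star_alg conj :=
  @StarAlg F conj leavitt_nualg leavitt_star leavitt_starD leavitt_starZ
    leavitt_starM leavitt_starK.

(* The elements p and p^* of the algebra, for the path p with arrows s
   starting at v (p is the vertex v when s is empty). *)
Definition lpath (v : vertex G) (s : seq (arrow G)) : leavitt :=
  foldl (fun x e => nmul x (larr e)) (lvert v) s.
Definition lpath_star (v : vertex G) (s : seq (arrow G)) : leavitt :=
  foldl (fun x e => nmul (lghost e) x) (lvert v) s.

Lemma star_lpath v s : star (lpath v s) = lpath_star v s.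
Proof.
rewrite /lpath /lpath_star.
have: star (lvert v : leavitt) = lvert v by rewrite /= leavitt_starE.
elim: s (lvert v : leavitt) {2 4}(lvert v : leavitt) => //= e s IHs x y xy.
by apply: IHs; rewrite leavitt_starM xy leavitt_starE.
Qed.

Lemma star_lpathM a u p v q :
  star (a *: nmul (lpath u p) (lpath_star v q)) =
  conj a *: nmul (lpath v q) (lpath_star u p).
Proof. by rewrite starZ starM -!star_lpath starK. Qed.

End Leavitt.

Arguments leavitt {F} G {conj} conjK.

(* Main.v *)
(** Send [e_i] to [e_i' q_i^*] and, conversely, [e_i'] to [e_i q_i], fixing the
    vertices and all other arrows. Both maps have the form [f |-> f w_f], and
    (CK1), (CK2) only require that [w_f^* w_f] and [w_f w_f^*] be the target of
    [f] in the domain graph and in the codomain graph respectively. For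
    [w_f = q_i] and [w_f = q_i^*] this holds because a path [q] without exits
    satisfies [q q^* = s(q)], by (CK2) at vertices emitting a single arrow. The
    two maps are mutually inverse because no [e_j] lies on a [q_i]: two cycles
    without exit that share an arrow are rotations of each other. *)

Require Import Defs.
From mathcomp Require Import all_boot all_algebra.
From mathcomp Require Import boolp.
From Stdlib Require List.

Set Implicit Arguments.
Unset Strict Implicit.
Unset Printing Implicit Defensive.

Import GRing.Theory.
Local Open Scope ring_scope.

(** * Paths and cycles *)

(** Both endpoints are recorded, unlike in [composable], so that the empty list is the trivial path
    at a vertex and a concatenation splits at an intermediate vertex. *)
Fixpoint walk (G : digraph) (v : vertex G) (p : seq (arrow G)) (u : vertex G) :
    Prop :=
  if p is f :: p' then source f = v /\ walk (target f) p' u else v = u.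

(** This is how the absence of exits is used. It passes from a cycle [e :: q] to [q], whereas [e]
    itself is an exit of a nonempty [q]. *)
Definition sole_arrows (G : digraph) (p : seq (arrow G)) : Prop :=
  forall f g, List.In f p -> source g = source f -> g = f.

Lemma walk_cat (G : digraph) (v u : vertex G) p p' :
  walk v (p ++ p') u <-> exists2 x, walk v p x & walk x p' u.
Proof.
elim: p v => [|f p IHp] v /=.
  by split=> [h|[x -> //]]; exists v.
split=> [[fv /IHp[x px xp']]|[x [fv px] xp']]; first by exists x.
by split=> //; apply/IHp; exists x.
Qed.

Lemma composable_walk (G : digraph) (f : arrow G) p :
  composable (f :: p) -> walk (target f) p (target (last f p)).
Proof.
elim: p f => [|g p IHp] f //= [fg gp].
by split; [rewrite fg | apply: IHp].
Qed.

Lemma In_map (T U : Type) (h : T -> U) (s : seq T) x :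
  List.In x s -> List.In (h x) (map h s).
Proof. exact: List.in_map. Qed.

Lemma NoDup_map_inj (T U : Type) (h : T -> U) (s : seq T) x y :
  List.NoDup (map h s) -> List.In x s -> List.In y s -> h x = h y -> x = y.
Proof.
elim: s => [|z s IHs] //= /List.NoDup_cons_iff[zs us].
case=> [<-|xs] [<-|ys] hxy //; last exact: IHs.
- by case: zs; rewrite hxy; apply: In_map.
- by case: zs; rewrite -hxy; apply: In_map.
Qed.

Lemma cycle_walk (G : digraph) (f : arrow G) p :
  is_cycle (f :: p) -> walk (target f) p (source f).
Proof. by case=> fp <- _; apply: composable_walk. Qed.

(** An arrow leaving a vertex of the cycle lies on the cycle, since it would otherwise be an exit;
    distinct sources then leave only one candidate. *)
Lemma cycle_sole_arrows (G : digraph) (p : seq (arrow G)) :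
  is_cycle p -> (~ exists f, is_exit p f) -> sole_arrows p.
Proof.
case: p => [|e p] // [_ _ up] noexit f g fp gf.
apply: (NoDup_map_inj up) (gf) => //.
apply: contrapT => gp; case: noexit; exists g; split=> //.
by exists f => //; left.
Qed.

(** Along [p] every step is forced, so the two walks can differ only in where they stop. Neither
    leaves [u] again, so both stop at the first arrival there. *)
Lemma walk_unique (G : digraph) (v u : vertex G) p p' :
  sole_arrows p -> walk v p u -> walk v p' u ->
  ~ List.In u (map source p) -> ~ List.In u (map source p') -> p = p'.
Proof.
elim: p v p' => [|f p IHp] v [|f' p'] //= sp.
- by move=> -> [-> _] _ []; left.
- by move=> [-> _] -> up _; case: up; left.
move=> [fv pu] [f'v p'u] up up'.
have ff' : f' = f by apply: sp; [left | rewrite fv].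
rewrite {}ff' in p'u *; congr (_ :: _); apply: IHp pu p'u _ _.
- by move=> g h gp; apply: sp; right.
- by move=> ?; apply: up; right.
- by move=> ?; apply: up'; right.
Qed.

(** Write [p] as [a ++ f :: b]. Then [q] and [b ++ e :: a] are both walks from the target of [f] to
    its source, and [walk_unique] identifies them. *)
Lemma cycle_rotation (G : digraph) (e f : arrow G) p q :
  is_cycle (e :: p) -> is_cycle (f :: q) -> sole_arrows (e :: p) ->
  List.In f p -> cyclic_rotation (e :: p) (f :: q).
Proof.
move=> cp cq sp fp; have [a [b pE]] := List.in_split f p fp.
rewrite -[(_ ++ _)%list]/(a ++ f :: b) in pE.
case: (cp) (cq) => _ _ up [_ _ uq].
have /walk_cat[x ax /= [fx bw]] : walk (target e) (a ++ f :: b) (source e).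
  by rewrite -pE; apply: cycle_walk.
exists (size (e :: a)); rewrite pE -cat_cons.
rewrite rot_size_cat /=; congr (_ :: _); apply/esym.
have inE g : List.In g (b ++ e :: a) -> List.In g (e :: p).
  rewrite pE => /List.in_app_iff /= => -[gb|[eg|ga]].
  - by right; apply/List.in_app_iff; right; right.
  - by left.
  - by right; apply/List.in_app_iff; left.
apply: (@walk_unique G (target f) (source f)).
- by move=> g h /inE; apply: sp.
- by apply/walk_cat; exists (source e) => //=; rewrite fx.
- exact: cycle_walk.
(* A return to the source of [f] before the end would repeat a source on the first cycle. *)
- move=> /List.in_map_iff[g [gf gb]].
  move: up; rewrite pE -cat_cons map_cat => up.
  case: (List.NoDup_remove_2 (map source (e :: a)) (map source b) _ up).
  rewrite -gf; case/List.in_app_iff: gb => [gb|ga].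
    by apply/List.in_app_iff; right; apply: In_map.
  by apply/List.in_app_iff; left; apply: (@In_map _ _ _ (e :: a)).
- by move: uq => /= /List.NoDup_cons_iff[].
Qed.

Lemma cycle_head_notin (G : digraph) (e : arrow G) p :
  is_cycle (e :: p) -> ~ List.In e p.
Proof.
by move=> [_ _] /= /List.NoDup_cons_iff[ep _] /(In_map source).
Qed.

(** * Computing in Leavitt path algebras *)

Lemma npiM (F : fieldType) (X : Type) (R : nterm F X -> nterm F X -> Prop) x y :
  npi R (TMul x y) = nmul (npi R x : presented_nualg R) (npi R y).
Proof. by rewrite /= pmulE. Qed.

(* Otherwise [/=] unfolds products in [leavitt] to the quotient construction. *)
Arguments nmul : simpl never.
Arguments star : simpl never.
Arguments leavitt : simpl never.

(** Seeing the quotient map as an evaluation turns formal sums into genuine ones and makes it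
    comparable with the morphisms of [morphism_eval]. *)
Lemma npi_eval (F : fieldType) (X : Type)
    (R : nterm F X -> nterm F X -> Prop) t :
  nterm_eval (A := presented_nualg R) (fun x => npi R (TGen x)) t = npi R t.
Proof.
elim: t => //= [x -> y ->|a x ->|x -> y ->]; first by rewrite npiD.
- by rewrite npiZ.
- by rewrite npiM.
Qed.

Lemma morphism_eval (F : fieldType) (X : Type)
    (R : nterm F X -> nterm F X -> Prop) (A : nualg F)
    (phi : {linear presented_nualg R -> A}) :
  (forall x y, phi (nmul x y) = nmul (phi x) (phi y)) ->
  forall t, phi (npi R t) = nterm_eval (fun x => phi (npi R (TGen x))) t.
Proof.
move=> phiM; elim=> //= [|x IHx y IHy|a x IHx|x IHx y IHy].
- by rewrite npi0; apply: (linear0 phi).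
- by rewrite -IHx -IHy npiD; apply: (linearD phi).
- by rewrite -IHx npiZ; exact: (linearZZ phi).
- by rewrite -IHx -IHy -phiM npiM.
Qed.

Lemma nterm_eval_sum (F : fieldType) (X T : Type) (A : nualg F) (h : X -> A)
    (s : seq T) (a : T -> nterm F X) :
  nterm_eval h (foldr (@TAdd F X) TZero [seq a x | x <- s]) =
  \sum_(x <- s) nterm_eval h (a x).
Proof. by elim: s => [|x s IHs] /=; rewrite ?big_nil ?big_cons ?IHs. Qed.

Section LeavittTheory.
Context (F : fieldType) (conj : {rmorphism F -> F}) (conjK : involutive conj).

Section Relations.
Context (G : digraph).
Local Notation L := (leavitt G conjK).
Local Notation "x ** y" := (nmul (x : L) (y : L))
  (at level 40, left associativity).

Lemma nmul0l (A : nualg F) (x : A) : nmul 0 x = 0.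
Proof. by apply: (addrI (nmul 0 x)); rewrite -nmulDl !addr0. Qed.

Lemma nmul0r (A : nualg F) (x : A) : nmul x 0 = 0.
Proof. by apply: (addrI (nmul x 0)); rewrite -nmulDr !addr0. Qed.

Ltac leavitt_relation :=
  rewrite /lvert /larr /lghost -?npi0 -?npiM; apply/npiP/nc_rel.

Lemma lvertM v : lvert F v ** lvert F v = lvert F v.
Proof. by leavitt_relation; apply: rel_VV. Qed.

Lemma lvertM0 (u v : vertex G) : u <> v -> lvert F u ** lvert F v = 0.
Proof. by move=> uv; leavitt_relation; apply: rel_V0. Qed.

Lemma lvert_larr (f : arrow G) : lvert F (source f) ** larr F f = larr F f.
Proof. by leavitt_relation; apply: rel_sE. Qed.

Lemma larr_lvert (f : arrow G) : larr F f ** lvert F (target f) = larr F f.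
Proof. by leavitt_relation; apply: rel_Et. Qed.

Lemma lvert_lghost (f : arrow G) :
  lvert F (target f) ** lghost F f = lghost F f.
Proof. by leavitt_relation; apply: rel_tE'. Qed.

Lemma lghost_lvert (f : arrow G) :
  lghost F f ** lvert F (source f) = lghost F f.
Proof. by leavitt_relation; apply: rel_E's. Qed.

Lemma lghost_larr (f : arrow G) : lghost F f ** larr F f = lvert F (target f).
Proof. by leavitt_relation; apply: rel_CK1. Qed.

Lemma lghost_larr0 (f g : arrow G) : f <> g -> lghost F f ** larr F g = 0.
Proof. by move=> fg; leavitt_relation; apply: rel_CK10. Qed.

Lemma lvert_sum (v : vertex G) (s : seq (arrow G)) :
  s <> [::] -> List.NoDup s -> (forall f, List.In f s <-> source f = v) ->
  lvert F v = \sum_(f <- s) larr F f ** lghost F f :> L.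
Proof.
move=> s0 us sP; have /npiP := nc_rel (rel_CK2 F s0 us sP).
by rewrite -[npi _ (foldr _ _ _)]npi_eval nterm_eval_sum.
Qed.

Lemma star_lvert (v : vertex G) : star (lvert F v : L) = lvert F v.
Proof. exact: leavitt_starE. Qed.

Lemma star_larr (f : arrow G) : star (larr F f : L) = lghost F f.
Proof. exact: leavitt_starE. Qed.

(** This is (CK2) with a single summand. *)
Lemma larr_lghost (f : arrow G) :
  (forall g, source g = source f -> g = f) ->
  larr F f ** lghost F f = lvert F (source f).
Proof.
move=> sf; rewrite (@lvert_sum _ [:: f]) ?big_seq1 //.
  by apply: List.NoDup_cons => //; apply: List.NoDup_nil.
by move=> g /=; split=> [[->|]//|/sf]; left.
Qed.

(** The product is nested to the right and ends in a vertex, unlike [lpath], so that it unfolds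
    along the recursion of [walk]. *)
Fixpoint lwalk (p : seq (arrow G)) (u : vertex G) : L :=
  if p is f :: p' then larr F f ** lwalk p' u else lvert F u.

Lemma lvert_lwalk v p u : walk v p u -> lvert F v ** lwalk p u = lwalk p u.
Proof.
by case: p => [->|f p [<- _]] /=; [exact: lvertM | rewrite nmulA lvert_larr].
Qed.

Lemma lwalk_lvert p u : lwalk p u ** lvert F u = lwalk p u.
Proof. by elim: p => [|f p IHp] /=; [exact: lvertM | rewrite -nmulA IHp]. Qed.

(** The product collapses from the middle: (CK1) turns $f^*f$ into $t(f)$, which the rest of the
    path absorbs. *)
Lemma star_lwalkM v p u :
  walk v p u -> star (lwalk p u) ** lwalk p u = lvert F u.
Proof.
elim: p v => [|f p IHp] v /=; first by rewrite star_lvert lvertM.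
move=> [_ pu]; rewrite starM star_larr -nmulA (nmulA (lghost F f : L)).
by rewrite lghost_larr (lvert_lwalk pu) (IHp _ pu).
Qed.

(** By induction the inner product is $t(f)$, and the remaining $ff^*$ is $s(f)$ because [f] is the
    only arrow leaving its source. *)
Lemma lwalkM_star v p u : sole_arrows p ->
  walk v p u -> lwalk p u ** star (lwalk p u) = lvert F v.
Proof.
elim: p v => [|f p IHp] v sp /=; first by move->; rewrite star_lvert lvertM.
move=> [fv pu]; rewrite starM star_larr -nmulA (nmulA (lwalk p u)).
rewrite (IHp (target f)) // => [|g h gp]; last by apply: sp; right.
rewrite lvert_lghost larr_lghost ?fv // => g gf.
by apply: sp => /=; [left | rewrite fv].
Qed.

End Relations.

(** * Star homomorphisms between Leavitt path algebras *)

Lemma star_morphism (G H : digraph)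
    (phi : {linear leavitt G conjK -> leavitt H conjK}) :
  (forall x y, phi (nmul x y) = nmul (phi x) (phi y)) ->
  (forall v, star (phi (lvert F v)) = phi (lvert F v)) ->
  (forall f, star (phi (larr F f)) = phi (lghost F f)) ->
  forall x, phi (star x) = star (phi x).
Proof.
move=> phiM phiV phiE; elim/(@npi_ind F _ (@leavitt_rel F G)) => t.
have starNpi t' : star (npi (@leavitt_rel F G) t' : leavitt G conjK) =
  npi _ (tstar conj t') by exact: leavitt_starE.
have mulNpi x y : npi (@leavitt_rel F G) (TMul x y) =
  nmul (npi _ x : leavitt G conjK) (npi _ y) by exact: npiM.
have phiD x y : phi (npi (@leavitt_rel F G) (TAdd x y)) =
  phi (npi _ x) + phi (npi _ y) by rewrite npiD; apply: (linearD phi).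
have phiZ a x : phi (npi (@leavitt_rel F G) (TScale a x)) =
  a *: phi (npi _ x) by rewrite npiZ; exact: (linearZZ phi).
have star0 : star (0 : leavitt H conjK) = 0.
  by apply: (addrI (star 0)); rewrite -starD !addr0.
rewrite starNpi; elim: t => /= [[v|f|f]||x IHx y IHy|a x IHx|x IHx y IHy].
- by rewrite -/(lvert F v) phiV.
- by rewrite -/(lghost F f) -/(larr F f) phiE.
(* On ghosts the claim is the adjoint of the one on arrows. *)
- by rewrite -/(lghost F f) -/(larr F f) -phiE starK.
- by rewrite npi0 (linear0 phi) star0.
- by rewrite !phiD starD IHx IHy.
- by rewrite !phiZ starZ IHx.
- by rewrite !mulNpi !phiM starM IHx IHy.
Qed.

(** Morphisms are determined on generators, and compatibility with the star settles the ghosts. This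
    serves to recognise the two composites as identities. *)
Lemma fixing_morphism (G : digraph)
    (phi : {linear leavitt G conjK -> leavitt G conjK}) :
  (forall x y, phi (nmul x y) = nmul (phi x) (phi y)) ->
  (forall x, phi (star x) = star (phi x)) ->
  (forall v, phi (lvert F v) = lvert F v) ->
  (forall f, phi (larr F f) = larr F f) ->
  phi =1 id.
Proof.
move=> phiM phiS phiV phiE; elim/(@npi_ind F _ (@leavitt_rel F G)) => t.
rewrite (morphism_eval phiM) -[RHS]npi_eval; congr nterm_eval.
apply: functional_extensionality_dep => -[v|f|f]; [exact: phiV | exact: phiE |].
by rewrite -[npi _ _]/(lghost F f) -[lghost F f](star_larr f) phiS phiE.
Qed.

Lemma lwalk_morphism (G H : digraph)
    (phi : {linear leavitt G conjK -> leavitt H conjK})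
    (hV : vertex G -> vertex H) (hE : arrow G -> arrow H) p u :
  (forall x y, phi (nmul x y) = nmul (phi x) (phi y)) ->
  phi (lvert F u) = lvert F (hV u) ->
  (forall f, List.In f p -> phi (larr F f) = larr F (hE f)) ->
  phi (lwalk p u) = lwalk (map hE p) (hV u).
Proof.
move=> phiM phiu; elim: p => //= f p IHp phip.
rewrite phiM phip; last by left.
by rewrite IHp // => g gp; apply: phip; right.
Qed.

(** The relations hold for the images $fw_f$ and $w_f^*f^*$: (CK1) since $w_f^*f^*fw_f=w_f^*w_f$,
    and (CK2) term by term since $fw_fw_f^*f^*=ff^*$. Sharing [V], [E] and [s] makes the two
    directions instances with [t1] and [t2] exchanged. *)
Lemma twist_morphism (V E : Type) (s t1 t2 : E -> V)
    (H := Digraph s t2) (w : E -> leavitt H conjK) :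
  (forall f, nmul (w f) (lvert F (t1 f : vertex H)) = w f) ->
  (forall f, nmul (star (w f)) (w f) = lvert F (t1 f : vertex H)) ->
  (forall f, nmul (w f) (star (w f)) = lvert F (t2 f : vertex H)) ->
  exists phi : {linear leavitt (Digraph s t1) conjK ->
                       leavitt H conjK},
    [/\ forall x y, phi (nmul x y) = nmul (phi x) (phi y),
        forall x, phi (star x) = star (phi x),
        forall v, phi (lvert F v) = lvert F (v : vertex H) &
        forall f, phi (larr F f) =
          nmul (larr F (f : arrow H) : leavitt H conjK)
               (w f)].
Proof.
move=> wt ws sw; set L := leavitt H conjK.
(* Here $w_fw_f^*w_f=w_f$ is used. *)
have tw f : nmul (lvert F (t2 f : vertex H) : L) (w f) = w f.
  by rewrite -sw -nmulA ws wt.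
have wst f : nmul (lvert F (t1 f : vertex H) : L) (star (w f))
    = star (w f).
  by rewrite -[in RHS]wt starM star_lvert.
pose h (g : leavitt_gen (Digraph s t1)) : L :=
  match g with
  | Vert v => lvert F (v : vertex H)
  | Arr f => nmul (larr F (f : arrow H) : L) (w f)
  | Ghost f => nmul (star (w f)) (lghost F (f : arrow H) : L)
  end.
have [x y xy|phi [phiM phiG]] := @presented_lift F _ (@leavitt_rel F _) L h.
  case: xy => {x y} /=.
  - by move=> v; apply: lvertM.
  - by move=> u v uv; exact: (@lvertM0 H).
  - by move=> f; rewrite nmulA (lvert_larr (f : arrow H)).
  - by move=> f; rewrite -nmulA wt.
  - by move=> f; rewrite nmulA wst.
  - by move=> f; rewrite -nmulA (lghost_lvert (f : arrow H)).
  - move=> f; rewrite -nmulA (nmulA (lghost F (f : arrow H) : L)).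
    by rewrite lghost_larr tw ws.
  - move=> f g fg.
    rewrite -nmulA (nmulA (lghost F (f : arrow H) : L)).
    by rewrite lghost_larr0 // nmul0l nmul0r.
  - move=> v p p0 up pP; rewrite nterm_eval_sum /=.
    rewrite (@lvert_sum H v p) //; apply: eq_bigr => f _.
    rewrite -nmulA (nmulA (w f)) sw nmulA.
    by rewrite (larr_lvert (f : arrow H)).
have phiV v : phi (lvert F v) = lvert F (v : vertex H).
  exact: phiG.
have phiE f : phi (larr F f) = nmul (larr F (f : arrow H) : L) (w f).
  exact: phiG.
exists phi; split=> //; apply: star_morphism => // [v|f].
  by rewrite phiV star_lvert.
by rewrite phiE starM star_larr; apply/esym/(phiG (Ghost f)).
Qed.

End LeavittTheory.

(** * Mutually inverse twists for the two digraphs *)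

Theorem lemma26 (F : fieldType) (conj : {rmorphism F -> F})
    (conjK : involutive conj) (G : digraph) (I : Type)
    (e : I -> arrow G) (q : I -> seq (arrow G))
    (hcycle : forall i : I, is_cycle (e i :: q i))
    (hdistinct : forall i j : I, i <> j ->
       ~ cyclic_rotation (e i :: q i) (e j :: q j))
    (hnoexit : forall i : I, ~ exists f : arrow G, is_exit (e i :: q i) f) :
  star_isomorphic (leavitt G conjK) (leavitt (replace_by_loops e) conjK).
Proof.
have sole i := cycle_sole_arrows (hcycle i) (@hnoexit i).
have eq_disj i j : ~ List.In (e j) (q i).
  have [<-|ij] := pselect (i = j); first exact: cycle_head_notin.
  by move=> ejq; apply: (hdistinct i j ij); apply: cycle_rotation.
have wq i := cycle_walk (hcycle i).
(* Once [G] is destructed, the two digraphs share vertices, arrows and sources and differ only in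
   their target maps. *)
case: G e q hcycle hdistinct hnoexit sole eq_disj wq => V E s t /= e q _ _ _.
move=> sole eq_disj wq; rewrite /replace_by_loops /=.
(* The twists need an actual index for each replaced arrow, which the propositional test in
   [replace_by_loops] does not supply. *)
have [k kP] : exists k : E -> option I, forall f,
    if k f is Some i then f = e i else ~ exists i, f = e i.
  suff /choice[k kP] : forall f, exists o : option I,
    if o is Some i then f = e i else ~ exists i, f = e i by exists k.
  by move=> f; have [[i fi]|fe] := pselect (exists i, f = e i);
    [exists (Some i) | exists None].
set t' := fun f => if _ then _ else _.
have t'E f : t' f = if k f is Some _ then s f else t f.
  rewrite /t'; move: (kP f).
  by case: (k f) => [i fi|nf]; case: pselect => // -[]; exists i.
(* The body of [t'] is forgotten; only its description through [k] remains. *)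
move: t' t'E => t' t'E.
pose G1 := Digraph s t; pose G2 := Digraph s t'.
have kq i f : List.In f (q i) -> k f = None.
  by move=> fq; have := kP f; case: (k f) => // j fj; case: (eq_disj i j);
    rewrite -fj.
(* No arrow of [q i] is replaced, so [q i] is still a path in the new digraph, with its old
   endpoints. *)
have wq' i : walk (t (e i) : vertex G2) (q i : seq (arrow G2)) (s (e i)).
  have t'q f : List.In f (q i) -> t' f = t f by rewrite t'E => /kq ->.
  move: (wq i) t'q; elim: (q i) (t (e i)) => //= f p IHp v [fv pw] t'p.
  split=> //; rewrite [t' f]t'p; last by left.
  by apply: IHp => // g gp; apply: t'p; right.
(* This depends on sources only, so it serves for [G2] as well. *)
have soleq i : @sole_arrows G1 (q i).
  by move=> f g fq; apply: (sole i); right.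
(* [w1] twists the map from [G2] to [G1], and [w2] the map from [G1] to [G2]. For an unreplaced
   arrow the twist is its target, so that $fw_f=f$. *)
pose w1 f : leavitt G1 conjK :=
  if k f is Some i then lwalk conjK (q i : seq (arrow G1)) (s f : vertex G1)
  else lvert F (t f : vertex G1).
pose w2 f : leavitt G2 conjK :=
  if k f is Some i
  then star (lwalk conjK (q i : seq (arrow G2)) (s f : vertex G2))
  else lvert F (t f : vertex G2).
have w1w f : nmul (w1 f) (lvert F (t' f : vertex G1)) = w1 f.
  rewrite /w1 t'E; case: (k f) => [i|]; last exact: (@lvertM _ _ conjK G1).
  exact: (@lwalk_lvert _ _ conjK G1).
have w1sw f : nmul (star (w1 f)) (w1 f) = lvert F (t' f : vertex G1).
  rewrite /w1 t'E; have := kP f; case: (k f) => [i ->|_].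
    exact: (@star_lwalkM _ _ conjK G1 _ _ _ (wq i)).
  by rewrite star_lvert; apply: (@lvertM _ _ conjK G1).
have w1ws f : nmul (w1 f) (star (w1 f)) = lvert F (t f : vertex G1).
  rewrite /w1; have := kP f; case: (k f) => [i ->|_].
    exact: (@lwalkM_star _ _ conjK G1 _ _ _ (soleq i) (wq i)).
  by rewrite star_lvert; apply: (@lvertM _ _ conjK G1).
have w2w f : nmul (w2 f) (lvert F (t f : vertex G2)) = w2 f.
  rewrite /w2; have := kP f; case: (k f) => [i ->|_].
    rewrite -{2}(@lvert_lwalk _ _ conjK G2 _ _ _ (wq' i)) starM.
    by rewrite star_lvert.
  exact: (@lvertM _ _ conjK G2).
have w2sw f : nmul (star (w2 f)) (w2 f) = lvert F (t f : vertex G2).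
  rewrite /w2; have := kP f; case: (k f) => [i ->|_].
    rewrite starK.
    exact: (@lwalkM_star _ _ conjK G2 _ _ _ (soleq i) (wq' i)).
  by rewrite star_lvert; apply: (@lvertM _ _ conjK G2).
have w2ws f : nmul (w2 f) (star (w2 f)) = lvert F (t' f : vertex G2).
  rewrite /w2 t'E; have := kP f; case: (k f) => [i ->|_].
    by rewrite starK; apply: (@star_lwalkM _ _ conjK G2 _ _ _ (wq' i)).
  by rewrite star_lvert; apply: (@lvertM _ _ conjK G2).
have [psi [psiM psiS psiV psiE]] := twist_morphism w1w w1sw w1ws.
have [phi [phiM phiS phiV phiE]] := twist_morphism w2w w2sw w2ws.
have phiq i f : List.In f (q i) -> phi (larr F (f : arrow G1)) =
    larr F (f : arrow G2).
  move=> /kq kf; rewrite phiE /w2 kf.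
  by have := @larr_lvert _ _ conjK G2 f; rewrite /= t'E kf.
have psiq i f : List.In f (q i) -> psi (larr F (f : arrow G2)) =
    larr F (f : arrow G1).
  by move=> /kq kf; rewrite psiE /w1 kf; apply: (@larr_lvert _ _ conjK G1).
have phiw i : phi (lwalk conjK (q i : seq (arrow G1)) (s (e i) : vertex G1)) =
    lwalk conjK (q i : seq (arrow G2)) (s (e i) : vertex G2).
  rewrite (@lwalk_morphism _ _ conjK G1 G2 phi id id) ?map_id //.
  exact: phiq.
have psiw i : psi (lwalk conjK (q i : seq (arrow G2)) (s (e i) : vertex G2)) =
    lwalk conjK (q i : seq (arrow G1)) (s (e i) : vertex G1).
  rewrite (@lwalk_morphism _ _ conjK G2 G1 psi id id) ?map_id //.
  exact: psiq.
(* Each map carries one twist to the adjoint of the other, so a composite sends $f$ to $fw_fw_f^*$,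
   which is $f$ times its target. *)
have psi_w2 f : psi (w2 f) = star (w1 f).
  rewrite /w1 /w2; have := kP f; case: (k f) => [i ->|_].
    by rewrite psiS psiw.
  by rewrite psiV star_lvert.
have phi_w1 f : phi (w1 f) = star (w2 f).
  by rewrite /w1 /w2; have := kP f; case: (k f) => [i ->|_];
    rewrite ?starK ?phiw // phiV star_lvert.
exists phi; split=> //; exists psi.
- apply: (fixing_morphism (phi := psi \o phi)) => /= [x y|x|v|f].
  + by rewrite phiM psiM.
  + by rewrite phiS psiS.
  + by rewrite phiV psiV.
  rewrite phiE psiM psiE psi_w2 -nmulA w1ws.
  exact: (@larr_lvert _ _ conjK G1).
- apply: (fixing_morphism (phi := phi \o psi)) => /= [x y|x|v|f].
  + by rewrite psiM phiM.
  + by rewrite psiS phiS.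
  + by rewrite psiV phiV.
  rewrite psiE phiM phiE phi_w1 -nmulA w2ws.
  exact: (@larr_lvert _ _ conjK G2).
Qed.
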